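(* Let $Y_{\Pi_n}$ be the De Concini–Procesi arrangement model (with respect to the maximal building set) of the braid arrangement $\mathcal{A}_{n-1}$ in $V=\{x\in\mathbb{R}^n\mid\sum_i x_i=0\}$, and let $\omega\in Y_{\Pi_n}$. Then the stabilizer of $\omega$ with respect to the $\mathcal{S}_n$-action on $Y_{\Pi_n}$ is a direct product of copies of $\mathbb{Z}_2$: $$\mathrm{stab}_{Y_{\Pi_n}}(\omega)\cong\mathbb{Z}_2^h\qquad\text{for some } 0\le h\le\lfloor n/2\rfloor.$$
   Context: $\mathcal{S}_n$ acts on $\mathbb{R}^n$, and on $V=\{x\in\mathbb{R}^n\mid\sum_i x_i=0\}$, by $\sigma(x)=(x_{\sigma(1)},\ldots,x_{\sigma(n)})$. The braid arrangement $\mathcal{A}_{n-1}$ consists of the hyperplanes $\{x\in V\mid x_i=x_j\}$, $1\le i<j\le n$. Its intersection lattice (all intersections of these hyperplanes, including $V$ as the empty intersection, ordered by reverse inclusion) is the partition lattice $\Pi_n$, with least element $\hat 0=V$; elements of $\Pi_n$ are identified with the corresponding subspaces. Let $\mathcal{G}=\Pi_n\setminus\{\hat 0\}$ (the maximal building set) and $\mathcal{M}=V\setminus\bigcup\mathcal{A}_{n-1}$. The model $Y_{\Pi_n}$ is the closure of the image of $$\Phi:\mathcal{M}\to V\times\prod_{G\in\mathcal{G}}\mathbb{P}(V/G),\qquad\Phi(x)=(x,(\langle x,G\rangle/G)_{G\in\mathcal{G}}),$$ where $\langle\cdot,\cdot\rangle$ denotes linear span and $\mathbb{P}$ real projectivization.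 $\mathcal{S}_n$ acts on $V\times\prod_{G}\mathbb{P}(V/G)$ by $\gamma(x,(x_G)_G)=(\gamma(x),(\gamma(x_{\gamma^{-1}(G)}))_G)$; this restricts to an action on $Y_{\Pi_n}$, and $\mathrm{stab}_{Y_{\Pi_n}}(\omega)=\{\gamma\in\mathcal{S}_n\mid\gamma(\omega)=\omega\}$. *)

(* Defs.v *)
From HB Require Import structures.
From mathcomp Require Import all_boot all_order all_algebra all_fingroup.
From mathcomp Require Import generic_quotient ring_quotient.
From mathcomp Require Import all_classical all_reals all_analysis.
Set Implicit Arguments.
Unset Strict Implicit.
Unset Printing Implicit Defensive.
Import Order.TTheory GRing.Theory Num.Theory.
Import numFieldNormedType.Exports.
Local Open Scope classical_set_scope.
Local Open Scope ring_scope.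
Local Open Scope quotient_scope.

Section QuotientSpace.
Variables (K : fieldType) (V : vectType K) (G : {vspace V}).

Definition quotv : Type := Quotient.quot (pred_of_vspace G).
HB.instance Definition _ := GRing.Zmodule.on quotv.
HB.instance Definition _ := ZmodQuotient.on quotv.

Lemma eq_quotv (u v : V) : \pi_quotv u = \pi_quotv v <-> u - v \in G.
Proof.
rewrite (Quotient.idealrBE (pred_of_vspace G)).
by split=> [->//|/eqP].
Qed.

Lemma quotv_surj (x : quotv) : exists u, x = \pi_quotv u.
Proof. by exists (repr x); rewrite reprK. Qed.

Definition quotv_scale (a : K) (x : quotv) : quotv := \pi_quotv (a *: repr x).

Lemma pi_quotvZ_subproof (a : K) (u : V) :
  quotv_scale a (\pi_quotv u) = \pi_quotv (a *: u).
Proof.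
by apply/eq_quotv; rewrite -scalerBr memvZ //; apply/eq_quotv; rewrite reprK.
Qed.

Lemma pi_quotvD (u v : V) : \pi_quotv (u + v) = \pi_quotv u + \pi_quotv v.
Proof. exact: raddfD. Qed.

Lemma quotv_scaleA a b x :
  quotv_scale a (quotv_scale b x) = quotv_scale (a * b) x.
Proof. by have [u ->] := quotv_surj x; rewrite !pi_quotvZ_subproof scalerA. Qed.
Lemma quotv_scale1 : left_id 1 quotv_scale.
Proof. by move=> x; have [u ->] := quotv_surj x; rewrite pi_quotvZ_subproof scale1r. Qed.
Lemma quotv_scaleDr : right_distributive quotv_scale +%R.
Proof.
move=> a x y; have [u ->] := quotv_surj x; have [v ->] := quotv_surj y.
by rewrite -pi_quotvD !pi_quotvZ_subproof scalerDr pi_quotvD.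
Qed.
Lemma quotv_scaleDl x : {morph quotv_scale^~ x : a b / a + b}.
Proof.
move=> a b; have [u ->] := quotv_surj x.
by rewrite !pi_quotvZ_subproof scalerDl pi_quotvD.
Qed.
HB.instance Definition _ := GRing.Zmodule_isLmodule.Build K quotv
  quotv_scaleA quotv_scale1 quotv_scaleDr quotv_scaleDl.

Lemma pi_quotvZ (a : K) (u : V) : \pi_quotv (a *: u) = a *: \pi_quotv u.
Proof. by rewrite -pi_quotvZ_subproof. Qed.

Lemma pi_quotv_eq0 (u : V) : (\pi_quotv u == 0) = (u \in G).
Proof.
have -> : (0 : quotv) = \pi_quotv 0 by rewrite raddf0.
apply/eqP/idP => [/eq_quotv|uG]; first by rewrite subr0.
by apply/eq_quotv; rewrite subr0.
Qed.

End QuotientSpace.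

(* The projective space P(W) = (W \ {0}) / R^*, with the quotient of the
   subspace topology. *)
Section Projectivization.
Variables (R : realType) (W : preTopologicalLmodType R).

Definition nonzero : set W := [set w | w != 0].

Definition proportional (u v : nonzero) : bool :=
  `[< exists2 c : R, c != 0 & set_val u = c *: set_val v >].

Lemma proportional_equiv : equiv_class_of proportional.
Proof.
split=> [u|u v|v u w].
- by apply/asboolP; exists 1; rewrite ?oner_neq0 ?scale1r.
- apply/asboolP/asboolP => -[c c0 e]; exists c^-1; rewrite ?invr_eq0 //.
    by rewrite e scalerA mulVf ?scale1r.
  by rewrite e scalerA mulVf ?scale1r.
- move=> /asboolP[c c0 e] /asboolP[d d0 e']; apply/asboolP.
  by exists (c * d); rewrite ?mulf_neq0 // e e' scalerA.
Qed.

Canonical proportional_equiv_rel := EquivRelPack proportional_equiv.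

Definition proj_space : Type :=
  quotient_topology {eq_quot proportional}.
HB.instance Definition _ := Topological.on proj_space.
HB.instance Definition _ := Quotient.on proj_space.

Definition proj_line (w : W) (w0 : w != 0) : proj_space :=
  \pi_proj_space (SigSub (mem_set (w0 : nonzero w))).

Lemma eq_proj_line (u v : W) (u0 : u != 0) (v0 : v != 0) :
  proj_line u0 = proj_line v0 <-> exists2 c : R, c != 0 & u = c *: v.
Proof.
pose su : nonzero := SigSub (mem_set (u0 : nonzero u)).
pose sv : nonzero := SigSub (mem_set (v0 : nonzero v)).
have H : reflect (proj_line u0 = proj_line v0) (proportional su sv).
  exact: (@eqmodP _ proportional_equiv_rel su sv).
by split=> [/H/asboolP//|e]; apply/H/asboolP.
Qed.

Lemma proj_line_surj (p : proj_space) : exists u (u0 : u != 0), p = proj_line u0.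
Proof.
exists (set_val (repr p)), (set_valP (repr p)); rewrite -[LHS]reprK.
by congr (\pi _); apply: val_inj.
Qed.

Lemma proj_line_repr (u : W) (u0 : u != 0) :
  exists2 c : R, c != 0 & set_val (repr (proj_line u0)) = c *: u.
Proof.
apply/(eq_proj_line (set_valP (repr (proj_line u0))) u0).
rewrite -[RHS]reprK; congr (\pi _); exact: val_inj.
Qed.

End Projectivization.

Section BraidModel.
Variables (R : realType) (n : nat).

Definition coord_sum (x : 'rV[R]_n) : R^o := \sum_i x 0 i.
Fact coord_sum_is_linear : linear coord_sum.
Proof.
move=> a x y; rewrite /coord_sum scaler_sumr -big_split.
by apply: eq_bigr => i _; rewrite !mxE.
Qed.
HB.instance Definition _ :=
  GRing.isLinear.Build R 'rV[R]_n R^o _ coord_sum coord_sum_is_linear.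

Definition braidV : Type := subvs_of (lker (linfun coord_sum)).
HB.instance Definition _ := Vector.on braidV.
HB.instance Definition _ :=
  Topological.copy braidV
    (initial_topology (vsval : braidV -> 'rV[R]_n)).

Fact braidVP (x : 'rV[R]_n) :
  (x \in lker (linfun coord_sum)) = (\sum_i x 0 i == 0).
Proof. by rewrite memv_ker lfunE. Qed.

Definition coord_diff (i j : 'I_n) (x : braidV) : R^o :=
  vsval x 0 i - vsval x 0 j.
Fact coord_diff_is_linear i j : linear (coord_diff i j).
Proof.
move=> a x y; rewrite /coord_diff linearP !mxE scalerBr opprD !addrA.
by congr (_ + _); rewrite addrAC.
Qed.
HB.instance Definition _ i j :=
  GRing.isLinear.Build R braidV R^o _ (coord_diff i j)
    (@coord_diff_is_linear i j).

Definition braid_hyperplane (i j : 'I_n) : {vspace braidV} :=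
  lker (linfun (coord_diff i j)).

Lemma mem_braid_hyperplane i j (x : braidV) :
  (x \in braid_hyperplane i j) = (vsval x 0 i == vsval x 0 j).
Proof. by rewrite memv_ker lfunE subr_eq0. Qed.

(* The intersection lattice Pi_n; the empty intersection is V. *)
Definition partition_lattice : {pred {vspace braidV}} :=
  [pred X : {vspace braidV} |
    [exists S : {set 'I_n * 'I_n},
      [forall p in S, (p.1 < p.2)%N] &&
      (X == \bigcap_(p in S) braid_hyperplane p.1 p.2)%VS]].

Definition building_set : {pred {vspace braidV}} :=
  [pred G in partition_lattice | G != fullv].

Record building := Building
  { bspace :> {vspace braidV}; bspaceP : bspace \in building_set }.
HB.instance Definition _ := [isSub for bspace].

Definition complement : set braidV :=
  ~` \bigcup_(p in [set p : 'I_n * 'I_n | (p.1 < p.2)%N])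
       [set x | x \in braid_hyperplane p.1 p.2].

Lemma mem_lattice (S : {set 'I_n * 'I_n}) (x : braidV) :
  (x \in \bigcap_(p in S) braid_hyperplane p.1 p.2)%VS =
  [forall p in S, vsval x 0 p.1 == vsval x 0 p.2].
Proof.
rewrite memvE; apply/subv_bigcapP/forall_inP => H p pS.
  by rewrite -mem_braid_hyperplane memvE; exact: H.
by rewrite -memvE mem_braid_hyperplane; exact: H.
Qed.

Section QuotientTopology.
Variable G : {vspace braidV}.
(* The topology of quotient_topology, declared on quotv itself so that it is
   found together with the module structure. *)
Definition quotv_open (U : set (quotv G)) : Prop :=
  open (\pi_(quotv G) @^-1` U : set braidV).
Fact quotv_openT : quotv_open setT.
Proof. by rewrite /quotv_open preimage_setT; exact: openT. Qed.
Fact quotv_openI : setI_closed quotv_open.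
Proof. by move=> A B oA oB; exact: openI. Qed.
Fact quotv_open_bigU (I : Type) (f : I -> set (quotv G)) :
  (forall i, quotv_open (f i)) -> quotv_open (\bigcup_i f i).
Proof.
move=> of_; rewrite /quotv_open preimage_bigcup.
by apply: bigcup_open => i _; exact: of_.
Qed.
HB.instance Definition _ :=
  isOpenTopological.Build (quotv G) quotv_openT quotv_openI quotv_open_bigU.
End QuotientTopology.

Lemma complement_notin (x : complement) (G : building) : set_val x \notin bspace G.
Proof.
case: G => G /= /andP[/existsP[S /andP[/forall_inP Slt /eqP ->]] GT].
have [p pS] : exists p, p \in S.
  apply/existsP; apply: contraNT GT => /existsPn S0.
  by rewrite big_pred0 // => p; exact: negbTE (S0 p).
rewrite mem_lattice; apply/negP => /forall_inP/(_ _ pS) xp.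
have := set_valP x; apply; exists p => /=; first exact: Slt.
by rewrite mem_braid_hyperplane.
Qed.

Lemma complement_neq0 (x : complement) (G : building) :
  \pi_(quotv G) (set_val x) != 0.
Proof. by rewrite pi_quotv_eq0 complement_notin. Qed.

Definition ambient : Type :=
  (braidV * prod_topology (fun G : building => proj_space (quotv G)))%type.
HB.instance Definition _ := Topological.on ambient.

(* The G-component <x, G> / G is the line of V / G spanned by the class of x. *)
Definition Phi (x : complement) : ambient :=
  (set_val x, fun G => proj_line (complement_neq0 x G)).

Definition model : set ambient := closure (range Phi).

Fact permV_subproof (s : 'S_n) (x : braidV) :
  col_perm s (vsval x) \in lker (linfun coord_sum).
Proof.
have := subvsP x; rewrite !memv_ker !lfunE /= /coord_sum => /eqP xe.
apply/eqP; rewrite -[RHS]xe [RHS](reindex_inj (@perm_inj _ s)) /=.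
by apply: eq_bigr => i _; rewrite mxE.
Qed.
(* s(x) = (x_(s 0), ..., x_(s (n-1))): a left action for the product of 'S_n,
   where (s * t) i = t (s i). *)
Definition permV (s : 'S_n) (x : braidV) : braidV := Subvs (permV_subproof s x).
Lemma permVE s x i : vsval (permV s x) 0 i = vsval x 0 (s i).
Proof. by rewrite mxE. Qed.
Fact permV_is_linear s : linear (permV s).
Proof. by move=> a x y; apply/val_inj/rowP => i; rewrite !mxE. Qed.
HB.instance Definition _ s :=
  GRing.isLinear.Build R braidV braidV _ (permV s) (@permV_is_linear s).
Lemma permV1 : permV 1%g =1 id.
Proof. by move=> x; apply/val_inj/rowP => i; rewrite permVE perm1. Qed.
Lemma permVM s t x : permV (s * t)%g x = permV s (permV t x).
Proof. by apply/val_inj/rowP => i; rewrite !permVE permM. Qed.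

Lemma mem_permV s (G : {vspace braidV}) x :
  (x \in linfun (permV s) @: G)%VS = (permV s^-1%g x \in G).
Proof.
apply/memv_imgP/idP => [[y yG ->]|xG].
  by rewrite lfunE /= -permVM mulVg permV1.
by exists (permV s^-1%g x); rewrite // lfunE /= -permVM mulgV permV1.
Qed.

Fact building_act_subproof s (G : building) :
  (linfun (permV s) @: bspace G)%VS \in building_set.
Proof.
case: G => G /= /andP[/existsP[S /andP[/forall_inP Slt /eqP eG]] GT].
apply/andP; split; last first.
  apply: contra GT => /eqP GT; apply/eqP/vspaceP => x; rewrite memvf.
  have : permV s x \in (linfun (permV s) @: G)%VS by rewrite GT memvf.
  by rewrite mem_permV -permVM mulVg permV1.
pose T := [set q : 'I_n * 'I_n | (q.1 < q.2)%N &&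
  (((s q.1, s q.2) \in S) || ((s q.2, s q.1) \in S))]%SET.
apply/existsP; exists T; apply/andP; split.
  by apply/forall_inP => q; rewrite inE => /andP[].
apply/eqP/vspaceP => x; rewrite mem_permV eG !mem_lattice.
apply/forall_inP/forall_inP => H [i j] /=.
  rewrite inE /= => /andP[_ /orP[]] /H; rewrite !permVE /= !permK //.
  by rewrite eq_sym.
move=> ijS; rewrite !permVE.
have [lt|lt|e] := ltngtP (s^-1%g i) (s^-1%g j).
- by apply: (H (s^-1%g i, s^-1%g j)); rewrite inE /= lt !permKV ijS.
- rewrite eq_sym; apply: (H (s^-1%g j, s^-1%g i)).
  by rewrite inE /= lt !permKV ijS orbT.
- by rewrite (val_inj e).
Qed.
Definition building_act s (G : building) : building :=
  Building (building_act_subproof s G).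

Section ProjAct.
Variables (s : 'S_n) (G' G : {vspace braidV}).
(* G' = s^-1(G), so that s induces an isomorphism V / G' -> V / G. *)
Definition is_preim : Prop := forall v, (permV s v \in G) = (v \in G').

Definition quot_act (u : quotv G') : quotv G := \pi_(quotv G) (permV s (repr u)).

Hypothesis sG : is_preim.

Lemma quot_act_pi v : quot_act (\pi_(quotv G') v) = \pi_(quotv G) (permV s v).
Proof.
apply/eq_quotv; rewrite -raddfB sG; apply/eq_quotv.
by rewrite reprK.
Qed.

Lemma quot_actZ a u : quot_act (a *: u) = a *: quot_act u.
Proof.
by have [v ->] := quotv_surj u; rewrite -pi_quotvZ !quot_act_pi linearZ pi_quotvZ.
Qed.

Lemma quot_act_neq0 u : u != 0 -> quot_act u != 0.
Proof.
by have [v ->] := quotv_surj u; rewrite quot_act_pi !pi_quotv_eq0 sG.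
Qed.

Definition proj_act (p : proj_space (quotv G')) : proj_space (quotv G) :=
  proj_line (quot_act_neq0 (set_valP (repr p))).

Lemma proj_act_line u (u0 : u != 0) :
  proj_act (proj_line u0) = proj_line (quot_act_neq0 u0).
Proof.
have [c c0 e] := proj_line_repr u0.
apply/eq_proj_line; exists c => //; rewrite -quot_actZ; congr quot_act.
exact: e.
Qed.
End ProjAct.

Lemma preim_inv s (G : building) :
  is_preim s (building_act s^-1%g G) G.
Proof. by move=> v; rewrite mem_permV invgK. Qed.

(* The G-component of s(x, (x_H)_H) is s(x_(s^-1 G)). *)
Definition ambient_act (s : 'S_n) (w : ambient) : ambient :=
  (permV s w.1,
   fun G => proj_act (@preim_inv s G) (w.2 (building_act s^-1%g G))).

Lemma proj_act_eqidx s (w : forall G : building, proj_space (quotv G))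
    (G1 G2 : building) (G : {vspace braidV}) (h1 : is_preim s G1 G)
    (h2 : is_preim s G2 G) :
  G1 = G2 -> proj_act h1 (w G1) = proj_act h2 (w G2).
Proof. by move=> e; subst G2; rewrite (Prop_irrelevance h1 h2). Qed.

Lemma building_act1 G : building_act 1%g G = G.
Proof.
by apply/val_inj/vspaceP => x; rewrite /= mem_permV invg1 permV1.
Qed.
Lemma building_actM s t G :
  building_act (s * t)%g G = building_act s (building_act t G).
Proof.
by apply/val_inj/vspaceP => x; rewrite /= !mem_permV invMg permVM.
Qed.

Lemma ambient_act1 : ambient_act 1%g =1 id.
Proof.
case=> x w; rewrite /ambient_act /= permV1; congr pair.
apply: functional_extensionality_dep => G.
have h : is_preim 1%g G G by move=> v; rewrite permV1.
transitivity (proj_act h (w G)).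
  apply: (@proj_act_eqidx 1%g w (building_act 1^-1%g G) G).
  by rewrite invg1 building_act1.
have [u [u0 ->]] := proj_line_surj (w G); rewrite proj_act_line.
apply/eq_proj_line; exists 1; rewrite ?oner_neq0 // scale1r.
by have [v ->] := quotv_surj u; rewrite quot_act_pi // permV1.
Qed.

Lemma ambient_actM s t w :
  ambient_act (s * t)%g w = ambient_act s (ambient_act t w).
Proof.
case: w => x w; rewrite /ambient_act /= permVM; congr pair.
apply: functional_extensionality_dep => G.
set G1 := building_act s^-1%g G; set G2 := building_act t^-1%g G1.
have h1 : is_preim s G1 G := @preim_inv s G.
have h2 : is_preim t G2 G1 := @preim_inv t G1.
have h : is_preim (s * t)%g G2 G.
  by move=> v; rewrite permVM h1 h2.
transitivity (proj_act h (w G2)).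
  apply: (@proj_act_eqidx (s * t)%g w (building_act (s * t)^-1%g G) G2).
  by rewrite invMg building_actM.
have [u [u0 ->]] := proj_line_surj (w G2).
apply: (etrans _ (congr1 (proj_act (@preim_inv s G))
  (esym (proj_act_line (@preim_inv t G1) u0)))).
rewrite !proj_act_line.
apply/eq_proj_line; exists 1; rewrite ?oner_neq0 // scale1r.
have [v ->] := quotv_surj u.
by rewrite (quot_act_pi h) (quot_act_pi h2) (quot_act_pi h1) permVM.
Qed.

Definition stab (w : ambient) : {set 'S_n} :=
  [set s : 'S_n | `[< ambient_act s w = w >]]%SET.

Lemma stabP w s : s \in stab w <-> ambient_act s w = w.
Proof. by rewrite inE; split=> [/asboolW|?] //; exact: asboolT. Qed.

Lemma stab_group_set w : group_set (stab w).
Proof.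
apply/group_setP; split; first by apply/stabP; exact: ambient_act1.
by move=> s t /stabP ws /stabP wt; apply/stabP; rewrite ambient_actM wt.
Qed.
Canonical stab_group w := Group (stab_group_set w).

End BraidModel.

Arguments ambient R n : clear implicits.
Arguments model R n : clear implicits.

(* Main.v *)
(* Suppose gamma fixes omega and gamma^2 <> 1, and let G be the subspace of V
   fixed pointwise by gamma^2: it is a proper element of the partition lattice
   and gamma(G) = G. The line omega_G in V / G is gamma-stable, so gamma acts on
   it by a scalar of finite order, i.e. by 1 or -1, and gamma^2 acts trivially
   on it. But gamma^2 has finite order, so it has no nonzero fixed vector in
   V / G, a contradiction. Hence the stabilizer has exponent 2. An abelian
   permutation group embeds in the product of its orbits (by its action on
   orbit representatives), and an orbit of size 2^a contributes at most
   a <= 2^a / 2 to the rank. *)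
Require Import Defs.
From mathcomp Require Import all_boot all_order all_algebra all_fingroup.
From mathcomp Require Import all_classical all_reals all_analysis.
From mathcomp Require Import pgroup abelian mxabelem.

Set Implicit Arguments.
Unset Strict Implicit.
Unset Printing Implicit Defensive.
Import Order.TTheory GRing.Theory Num.Theory.
Local Open Scope ring_scope.

Section AbelianPermutationGroups.
Import mathcomp.boot.finset.
Local Open Scope group_scope.

Lemma acts_on_setT (T : finType) (A : {group {perm T}}) :
  [acts A, on [set: T] | 'P].
Proof. by apply/actsP=> a _ x; rewrite !inE. Qed.

Lemma card_abelian_perm_leq (T : finType) (A : {group {perm T}}) :
  abelian A ->
  (#|A| <= \prod_(O in orbit 'P A @: [set: T]) #|O|)%N.
Proof.
move=> /centsP cA.
have [trX _ _ sX] := orbit_transversalP (acts_on_setT A).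
set X := orbit_transversal _ _ _ in trX sX.
set P := orbit _ _ @: _ in trX *.
have partP : partition P [set: T] := orbit_partition (acts_on_setT A).
(* Points outside the transversal get a singleton of allowed values, so the family [F] has as many
   members as the product of the orbit sizes. *)
pose F x : {set T} := if x \in X then orbit 'P A x else [set x].
pose f (a : {perm T}) := [ffun x => if x \in X then a x else x].
have injf : {in A &, injective f}.
  move=> a b aA bA /ffunP fab; apply/permP => x.
  (* [c] carries [x] to its representative, where [a] and [b] agree; commuting both past [c] and
     cancelling [c] gives agreement at [x]. *)
  have [c cAc xcX] := sX x (in_setT x).
  have := fab (c x); rewrite !ffunE !ifT //.
  rewrite -!permM (cA c cAc a aA) (cA c cAc b bA) !permM.
  exact: perm_inj.
rewrite -(card_in_imset injf).
apply: (@leq_trans #|family F|).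
  apply/subset_leq_card/fintype.subsetP => _ /imsetP[a aA ->].
  apply/familyP => x; rewrite ffunE /F.
  by case: ifP => xX; [exact: mem_orbit | rewrite inE].
rewrite card_family foldrE big_map big_enum /=.
rewrite (bigID (mem X)) /= [X in (_ * X)%N]big1 ?muln1; last first.
  by move=> x /negbTE xX; rewrite /F xX cards1.
rewrite -(pblock_transversal trX) (big_imset _ (pblock_inj trX)) /=.
apply: leq_prod => x xX; rewrite /F xX.
suff -> : pblock P x = orbit 'P A x by [].
apply: def_pblock; first by case/and3P: partP.
  by apply: imset_f; rewrite inE.
exact: orbit_refl.
Qed.

Lemma abelem2_perm_rank (T : finType) (A : {group {perm T}}) :
  2.-abelem A -> (logn 2 #|A| <= #|T|./2)%N.
Proof.
move=> abA; have [pA cA _] := and3P abA.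
have := card_partition (orbit_partition (acts_on_setT A)).
rewrite cardsT => ->; set P := orbit _ _ @: _.
rewrite -(@leq_exp2l 2) // -p_part part_pnat_id //.
apply: leq_trans (card_abelian_perm_leq cA) _; rewrite -/P.
apply: (@leq_trans (\prod_(O in P) 2 ^ #|O|./2)%N).
  apply: leq_prod => _ /imsetP[x _ ->].
  have /p_natP[a ->] : 2%N.-nat #|orbit 'P A x|.
    by apply: pnat_dvd pA; exact: dvdn_orbit.
  (* For a nontrivial orbit this is a + 1 <= 2 ^ a; a fixed point contributes exponent 0. *)
  by case: a => // a; rewrite leq_exp2l // expnS mul2n doubleK ltn_expl.
rewrite -expn_sum leq_exp2l // geq_half_double -mul2n big_distrr /=.
by apply: leq_sum => O _; rewrite mul2n -geq_half_double.
Qed.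

End AbelianPermutationGroups.

Section Stabilizer.
Variables (R : realType) (n : nat).

Lemma permVX (s : 'S_n) k (x : braidV R n) :
  permV (s ^+ k)%g x = iter k (permV s) x.
Proof. by elim: k => [|k IHk]; rewrite ?permV1 // expgS permVM IHk. Qed.

(** With g = s v - v fixed by s, s^k v = v + k g. At k = [#[s]] this gives [#[s]] g = 0, hence g = 0
    in characteristic 0. So s fixes no nonzero vector of V modulo its fixed space. *)
Lemma permV_fix_mod (s : 'S_n) (v : braidV R n) :
  permV s (permV s v - v) = permV s v - v -> permV s v = v.
Proof.
set g := permV s v - v => sg.
have sv : permV s v = v + g by rewrite addrC subrK.
move: g sg sv => g sg sv.
have iterE k : iter k (permV s) v = v + g *+ k.
  elim: k => [|k /= ->]; first by rewrite addr0.
  by rewrite linearD linearMn /= sv sg -addrA -mulrS.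
have := iterE #[s]%g; rewrite -permVX expg_order permV1 => /eqP.
rewrite addrC -subr_eq subrr eq_sym -scaler_nat scaler_eq0 pnatr_eq0.
by rewrite -leqn0 leqNgt order_gt0 sv => /eqP ->; rewrite addr0.
Qed.

(** The pairs {i, s i}, listed in increasing order as [partition_lattice] demands. *)
Definition fixed_pairs (s : 'S_n) : {set 'I_n * 'I_n} :=
  [set p : 'I_n * 'I_n | (p.1 < p.2)%N && ((p.2 == s p.1) || (p.1 == s p.2))]%SET.

Definition fixV (s : 'S_n) : {vspace braidV R n} :=
  (\bigcap_(p in fixed_pairs s) braid_hyperplane R p.1 p.2)%VS.

Lemma mem_fixV (s : 'S_n) x : (x \in fixV s) = (permV s x == x).
Proof.
rewrite mem_lattice; apply/forall_inP/eqP => [H|xs [i j]].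
  apply/val_inj/rowP => i; rewrite permVE.
  have [lt|lt|/val_inj<- //] := ltngtP i (s i).
    by apply/esym/eqP/(H (i, s i)); rewrite inE lt eqxx.
  by apply/eqP/(H (s i, i)); rewrite inE lt eqxx orbT.
by rewrite inE /= => /andP[_ /orP[] /eqP ->]; rewrite -permVE xs.
Qed.

Lemma permV_faithful (s : 'S_n) :
  (forall x : braidV R n, permV s x = x) -> s = 1%g.
Proof.
(* If s i <> i, the vector [e] has coordinate 1 at i and -1 at s i, so s moves it. *)
move=> sV; apply/permP => i; rewrite perm1; apply/eqP/negPn/negP => si.
pose e : 'rV[R]_n := delta_mx 0 i - delta_mx 0 (s i).
have eV : e \in lker (linfun (@coord_sum R n)).
  have sum_delta j : \sum_k (delta_mx 0 j : 'rV[R]_n) 0 k = 1.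
    rewrite (bigD1 j) //= mxE !eqxx big1 ?addr0 // => k /negPf kj.
    by rewrite mxE kj andbF.
  rewrite braidVP; under eq_bigr do rewrite mxE [X in _ + X]mxE.
  by rewrite sumrB !sum_delta subrr.
have := congr1 (fun x : braidV R n => vsval x 0 i) (sV (Subvs eV)).
rewrite permVE /= !mxE !eqxx /= (negPf si) (eq_sym i) (negPf si) sub0r subr0.
by move/eqP; rewrite eq_sym -subr_eq0 opprK -mulr2n pnatr_eq0.
Qed.

Lemma fixV_building (s : 'S_n) : s != 1%g -> fixV s \in @building_set R n.
Proof.
move=> s1; apply/andP; split.
  apply/existsP; exists (fixed_pairs s); rewrite eqxx andbT.
  by apply/forall_inP => p; rewrite inE => /andP[].
apply: contraNN s1 => /eqP fT; apply/eqP/permV_faithful => x.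
by apply/eqP; rewrite -mem_fixV fT memvf.
Qed.

(** Modulo G, s^k v is c^k v. Since v is not in G, the finite order of s makes c a root of unity;
    being real, c has square 1. *)
Lemma permV_eigen_mod (s : 'S_n) (G : {vspace braidV R n}) (c : R) v :
  (forall x, (permV s x \in G) = (x \in G)) ->
  v \notin G -> permV s v - c *: v \in G ->
  permV (s * s)%g v - v \in G.
Proof.
move=> sG vG svG.
have iterE k : iter k (permV s) v - c ^+ k *: v \in G.
  elim: k => [|k IHk] /=; first by rewrite expr0 scale1r subrr mem0v.
  rewrite -[X in X - _](subrK (c ^+ k *: permV s v)) -addrA memvD //.
    by rewrite -linearZ -linearB sG.
  by rewrite exprSr -scalerA -scalerBr memvZ.
have := iterE #[s]%g; rewrite -permVX expg_order permV1.
rewrite -[X in X - _]scale1r -scalerBl => cvG.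
have c1 : c ^+ #[s]%g = 1.
  apply/esym/eqP; rewrite -subr_eq0; apply: contraNT vG => c1.
  by rewrite -(scale1r v) -(mulVf c1) -scalerA memvZ.
have /eqP cc1 : `|c| == 1.
  by rewrite -(@pexpr_eq1 _ _ #[s]%g) ?order_gt0 // -normrX c1 normr1.
by have := iterE 2; rewrite -real_normK ?num_real // cc1 expr1n scale1r permVM.
Qed.

Lemma stab_square (w : ambient R n) s : s \in stab w -> (s * s = 1)%g.
Proof.
move=> /stabP sw; apply/eqP/negPn/negP => ss1.
pose G : building R n := Building (fixV_building ss1).
(* s commutes with its square, hence preserves the fixed space of the square. *)
have sG : is_preim s G G.
  have sK : cancel (@permV R n s) (permV s^-1%g).
    by move=> x; rewrite -permVM mulVg permV1.
  by move=> v; rewrite !mem_fixV -permVM -mulgA permVM (can_eq sK).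
have GE : building_act s^-1%g G = G.
  by apply/val_inj/vspaceP => x; rewrite /= mem_permV invgK; exact: sG.
(* The G-component of s w comes from index s^-1 G, equal to G only propositionally, hence the
   transport by [proj_act_eqidx]. *)
have : proj_act sG (w.2 G) = w.2 G.
  have := congr1 (fun u : ambient R n => u.2 G) sw; rewrite /= => wG.
  apply: etrans wG.
  exact: (@proj_act_eqidx _ _ _ w.2 _ _ _ sG (@preim_inv _ _ s G) (esym GE)).
have [u [u0 ->]] := proj_line_surj (w.2 G).
rewrite proj_act_line => /eq_proj_line[c c0].
have [v uE] := quotv_surj u; move: u0; rewrite uE.
rewrite pi_quotv_eq0 => vG; rewrite (quot_act_pi sG) -pi_quotvZ => /eq_quotv svG.
have := permV_eigen_mod sG vG svG.
rewrite mem_fixV => /eqP/permV_fix_mod ssv.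
by case/negP: vG; rewrite mem_fixV ssv.
Qed.

End Stabilizer.

Theorem theorem7p1 (R : realType) (n : nat) (omega : ambient R n)
    (omega_in_Y : model R n omega) :
  exists2 h : nat, (h <= n./2)%N
    & (stab_group omega \isog [set: 'rV['Z_2]_h])%g.
Proof.
have ab : (2.-abelem (stab_group omega))%g.
  apply/exponent2_abelem/exponentP => s /stab_square.
  by rewrite expgS expg1.
exists (logn 2 #|stab_group omega|).
  by have := abelem2_perm_rank ab; rewrite card_ord.
(* Elementary abelian 2-groups are classified by their order, here 2 ^ h on both sides. *)
rewrite (isog_abelem_card _ ab); apply/andP; split.
  exact: (@mx_Fp_abelem 2 1 _ isT).
rewrite cardsT card_mx mul1n card_ord.
have [pA _ _] := and3P ab.
by rewrite -[X in _ == X](part_pnat_id pA) p_part.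
Qed.
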